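(* Let $R$ be a commutative Noetherian ring and let $A$ be a projective Noetherian $R$-algebra. Let $Q\in A\text{-mod}\cap R\text{-proj}$ be such that $\operatorname{Hom}_A(Q,Q)\in R\text{-proj}$, and let $B=\operatorname{End}_A(Q)^{op}$. For $M\in A\text{-mod}\cap R\text{-proj}$ let $\chi^r_{DM}\colon \operatorname{Hom}_A(DQ,DM)\otimes_B DQ\to DM$ be the homomorphism of right $A$-modules $f\otimes h\mapsto f(h)$, where $\operatorname{Hom}_A(DQ,DM)$ denotes homomorphisms of right $A$-modules. Then for every $M\in A\text{-mod}\cap R\text{-proj}$: (i) $\chi^r_{DM}$ is surjective if and only if $Q\text{-}\operatorname{domdim}_{(A,R)}M\geq 1$; (ii) $\chi^r_{DM}$ is an isomorphism if and only if $Q\text{-}\operatorname{domdim}_{(A,R)}M\geq 2$.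
   Context: A projective Noetherian $R$-algebra is an $R$-algebra that is finitely generated and projective as an $R$-module. $A\text{-mod}$ is the category of finitely generated left $A$-modules, $R\text{-proj}$ is the category of finitely generated projective $R$-modules, and $D=\operatorname{Hom}_R(-,R)$, which sends left $A$-modules to right $A$-modules and conversely. For a module $T$, $\operatorname{add}T$ is the full subcategory of direct summands of finite direct sums of copies of $T$. $Q$ is a right $B$-module, so $DQ$ is a left $B$-module, and $\operatorname{Hom}_A(DQ,DM)\cong\operatorname{Hom}_A(M,Q)$ is a right $B$-module. An exact sequence of $A$-modules is $(A,R)$-exact if it splits as a sequence of $R$-modules; an $(A,R)$-monomorphism is an $A$-homomorphism $f\colon M\to N$ such that $0\to M\xrightarrow{f}N$ is $(A,R)$-exact (i.e. $f$ is split injective over $R$). A left $\operatorname{add}T$-approximation of $X$ is an $A$-homomorphism $X\to N$ with $N\in\operatorname{add}T$ such that $\operatorname{Hom}_A(N,Y)\to\operatorname{Hom}_A(X,Y)$ is surjective for all $Y\in\operatorname{add}T$. Relative dominant dimension: for $T,X\in A\text{-mod}\cap R\text{-proj}$, if $X$ admits no left $\operatorname{add}T$-approximation which is an $(A,R)$-monomorphism then $T\text{-}\operatorname{domdim}_{(A,R)}X=0$. Otherwise $T\text{-}\operatorname{domdim}_{(A,R)}X\in\mathbb N\cup\{+\infty\}$ is the supremum of all $n\in\mathbb N$ such that there is an $(A,R)$-exact sequence $0\to X\to T_1\to\cdots\to T_n$ with all $T_i\in\operatorname{add}T$ which remains exact under $\operatorname{Hom}_A(-,T)$, i.e. $\operatorname{Hom}_A(T_n,T)\to\cdots\to\operatorname{Hom}_A(T_1,T)\to\operatorname{Hom}_A(X,T)\to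 0$ is exact. *)

(* Defs.v *)
From HB Require Import structures.
From mathcomp Require Import all_boot all_algebra.
From mathcomp Require Import boolp.

Set Implicit Arguments.
Unset Strict Implicit.
Unset Printing Implicit Defensive.

Import GRing.Theory.
Local Open Scope ring_scope.
Local Open Scope quotient_scope.

(* Throughout, a right module over a ring [S] is a left module over the converse
   ring [S^c].  R-algebras are given by a central ring morphism from R rather than
   by the library's [algType], which excludes the zero algebra. *)
Record algebra (R : comPzRingType) : Type := Algebra {
  alg_ring :> pzRingType;
  alg_map : {rmorphism R -> alg_ring};
  alg_central : forall r a, alg_map r * a = a * alg_map r
}.

Definition surjective (X Y : Type) (f : X -> Y) : Prop :=
  forall y, exists x, f x = y.

Section Finiteness.

Definition ideal (R : comPzRingType) (I : R -> Prop) : Prop :=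
  [/\ I 0, forall x y, I x -> I y -> I (x + y) & forall a x, I x -> I (a * x)].

Definition noetherian (R : comPzRingType) : Prop :=
  forall I : R -> Prop, ideal I ->
    exists n (g : 'I_n -> R),
      forall x, I x <-> exists c : 'I_n -> R, x = \sum_i c i * g i.

Variable S : pzRingType.

Definition fin_gen (M : lmodType S) : Prop :=
  exists n (g : 'I_n -> M), forall x, exists c : 'I_n -> S, x = \sum_i c i *: g i.

Definition projective (P : lmodType S) : Prop :=
  forall (X Y : lmodType S) (p : {linear X -> Y}) (f : {linear P -> Y}),
    surjective p -> exists g : {linear P -> X}, forall x, p (g x) = f x.

Definition fg_projective (P : lmodType S) : Prop := fin_gen P /\ projective P.

End Finiteness.

Section HomGroup.
Variables (S : pzRingType) (U V : lmodType S).
Implicit Types f g h : {linear U -> V}.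

Lemma linear_ext f g : f =1 g -> f = g.
Proof.
case: f g => [f cf] [g cg] /= /funext fg; move: cf; rewrite fg => cf.
congr (GRing.Linear.Pack _).
case: cf cg => [[a0] [b0]] [[a1] [b1]].
by rewrite (Prop_irrelevance a0 a1) (Prop_irrelevance b0 b1).
Qed.

HB.instance Definition _ := gen_eqMixin {linear U -> V}.
HB.instance Definition _ := gen_choiceMixin {linear U -> V}.

Definition hom_zero : {linear U -> V} := \0.
Definition hom_opp f : {linear U -> V} := \- f.
Definition hom_add f g : {linear U -> V} := f \+ g.

Lemma hom_addA : associative hom_add.
Proof. by move=> f g h; apply: linear_ext => x /=; rewrite addrA. Qed.
Lemma hom_addC : commutative hom_add.
Proof. by move=> f g; apply: linear_ext => x /=; rewrite addrC. Qed.
Lemma hom_add0 : left_id hom_zero hom_add.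
Proof. by move=> f; apply: linear_ext => x /=; rewrite add0r. Qed.
Lemma hom_addN : left_inverse hom_zero hom_opp hom_add.
Proof. by move=> f; apply: linear_ext => x /=; rewrite addNr. Qed.

HB.instance Definition _ := GRing.isZmodule.Build {linear U -> V}
  hom_addA hom_addC hom_add0 hom_addN.

Lemma homDE f g x : (f + g) x = f x + g x. Proof. by []. Qed.
Lemma hom0E x : (0 : {linear U -> V}) x = 0. Proof. by []. Qed.

End HomGroup.

Section EndRing.
Variables (S : pzRingType) (M : lmodType S).

Definition endo : Type := {linear M -> M}.
HB.instance Definition _ := GRing.Zmodule.on endo.

Definition endo_one : endo := idfun : {linear M -> M}.
Definition endo_mul (f g : endo) : endo :=
  (f : {linear M -> M}) \o (g : {linear M -> M}).

Lemma endo_mulA : associative endo_mul.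
Proof. by move=> f g h; apply: linear_ext. Qed.
Lemma endo_mul1 : left_id endo_one endo_mul.
Proof. by move=> f; apply: linear_ext. Qed.
Lemma endo_1mul : right_id endo_one endo_mul.
Proof. by move=> f; apply: linear_ext. Qed.
Lemma endo_mulDl : left_distributive endo_mul +%R.
Proof. by move=> f g h; apply: linear_ext. Qed.
Lemma endo_mulDr : right_distributive endo_mul +%R.
Proof. by move=> f g h; apply: linear_ext => x; apply: (linearD f). Qed.

HB.instance Definition _ := GRing.Zmodule_isPzRing.Build endo
  endo_mulA endo_mul1 endo_1mul endo_mulDl endo_mulDr.

End EndRing.

(* X (x)_S Y for a right S-module X and a left S-module Y: finite formal sums of
   pure tensors modulo the congruence generated by biadditivity and balancedness.
   Opposites need not be adjoined, since (- x) (x) y is opposite to x (x) y. *)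
Section Tensor.
Variables (S : pzRingType) (X : lmodType S^c) (Y : lmodType S).

Inductive tens_rel : seq (X * Y) -> seq (X * Y) -> Prop :=
| TensRefl s : tens_rel s s
| TensSym s t : tens_rel s t -> tens_rel t s
| TensTrans s t u : tens_rel s t -> tens_rel t u -> tens_rel s u
| TensCat s1 t1 s2 t2 :
    tens_rel s1 t1 -> tens_rel s2 t2 -> tens_rel (s1 ++ s2) (t1 ++ t2)
| TensComm s t : tens_rel (s ++ t) (t ++ s)
| TensZero y : tens_rel [:: (0, y)] [::]
| TensDl x x' y : tens_rel [:: (x + x', y)] [:: (x, y); (x', y)]
| TensDr x y y' : tens_rel [:: (x, y + y')] [:: (x, y); (x, y')]
| TensBal x (b : S) y : tens_rel [:: ((b : S^c) *: x, y)] [:: (x, b *: y)].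

Definition tens_relb (s t : seq (X * Y)) : bool := `[< tens_rel s t >].

Lemma tens_relb_refl : reflexive tens_relb.
Proof. by move=> s; apply/asboolP; constructor. Qed.
Lemma tens_relb_sym : symmetric tens_relb.
Proof. by move=> s t; apply/asboolP/asboolP; apply: TensSym. Qed.
Lemma tens_relb_trans : transitive tens_relb.
Proof.
by move=> s t u /asboolP h /asboolP h'; apply/asboolP; apply: TensTrans h h'.
Qed.

Canonical tens_equiv :=
  EquivRel tens_relb tens_relb_refl tens_relb_sym tens_relb_trans.

Definition tensor : Type := {eq_quot tens_equiv}.
HB.instance Definition _ := Choice.on tensor.
HB.instance Definition _ := EqQuotient.on tensor.

Lemma tens_eqP s t : reflect (tens_rel s t) (\pi_tensor s == \pi_tensor t).
Proof. by rewrite eqmodE; apply: asboolP. Qed.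

Lemma tens_piW (P : tensor -> Prop) : (forall s, P (\pi_tensor s)) -> forall t, P t.
Proof. by move=> Ppi t; rewrite -[t]reprK. Qed.

Lemma tens_repr s : tens_rel (repr (\pi_tensor s)) s.
Proof. by apply/tens_eqP; rewrite reprK. Qed.

Definition tens_neg (s : seq (X * Y)) := [seq (- p.1, p.2) | p <- s].

Lemma tens_negK s : tens_rel (tens_neg s ++ s) [::].
Proof.
elim: s => [|[x y] s IHs] /=; first exact: TensRefl.
have swap : tens_rel ((- x, y) :: tens_neg s ++ (x, y) :: s)
                     ([:: (- x, y); (x, y)] ++ (tens_neg s ++ s)).
  have := TensCat (TensComm (tens_neg s) [:: (x, y)]) (TensRefl s).
  by rewrite -!catA /=; apply: (TensCat (TensRefl [:: (- x, y)])).
apply: TensTrans swap _.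
apply: (@TensTrans _ ([::] ++ (tens_neg s ++ s))) IHs.
apply: TensCat (TensRefl _); apply: TensTrans (TensSym (TensDl _ _ _)) _.
by rewrite addNr; apply: TensZero.
Qed.

Lemma tens_neg_congr s t : tens_rel s t -> tens_rel (tens_neg s) (tens_neg t).
Proof.
elim=> [u|u v _ h|u v w _ h _ h'|s1 t1 s2 t2 _ h _ h'|u v|y|x x' y|x y y'|x b y].
- exact: TensRefl.
- exact: TensSym.
- exact: TensTrans h h'.
- by rewrite /tens_neg !map_cat; apply: TensCat.
- by rewrite /tens_neg !map_cat; apply: TensComm.
- by rewrite /= oppr0; apply: TensZero.
- by rewrite /= opprD; apply: TensDl.
- exact: TensDr.
- by rewrite /= -scalerN; apply: TensBal.
Qed.

Definition tens0 : tensor := \pi_tensor [::].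
Definition tens_add (t u : tensor) : tensor := \pi_tensor (repr t ++ repr u).
Definition tens_opp (t : tensor) : tensor := \pi_tensor (tens_neg (repr t)).

Lemma tens_add_pi s t :
  tens_add (\pi_tensor s) (\pi_tensor t) = \pi_tensor (s ++ t).
Proof. by apply/eqP/tens_eqP; apply: TensCat; apply: tens_repr. Qed.
Lemma tens_opp_pi s : tens_opp (\pi_tensor s) = \pi_tensor (tens_neg s).
Proof. by apply/eqP/tens_eqP; apply: tens_neg_congr; apply: tens_repr. Qed.

Lemma tens_addA : associative tens_add.
Proof.
move=> s t u; elim/tens_piW: s => s; elim/tens_piW: t => t; elim/tens_piW: u => u.
by rewrite !tens_add_pi catA.
Qed.
Lemma tens_addC : commutative tens_add.
Proof.
move=> s t; elim/tens_piW: s => s; elim/tens_piW: t => t; rewrite !tens_add_pi.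
by apply/eqP/tens_eqP; apply: TensComm.
Qed.
Lemma tens_add0 : left_id tens0 tens_add.
Proof. by move=> s; elim/tens_piW: s => s; rewrite tens_add_pi. Qed.
Lemma tens_addN : left_inverse tens0 tens_opp tens_add.
Proof.
move=> s; elim/tens_piW: s => s; rewrite tens_opp_pi tens_add_pi.
by apply/eqP/tens_eqP; apply: tens_negK.
Qed.

HB.instance Definition _ := GRing.isZmodule.Build tensor
  tens_addA tens_addC tens_add0 tens_addN.

Definition tens (x : X) (y : Y) : tensor := \pi_tensor [:: (x, y)].

Lemma tens_pi s : \pi_tensor s = \sum_(p <- s) tens p.1 p.2.
Proof.
elim: s => [|[x y] s IHs]; first by rewrite big_nil.
by rewrite big_cons -IHs; apply/esym; apply: tens_add_pi.
Qed.

Lemma tensDl x x' y : tens (x + x') y = tens x y + tens x' y.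
Proof.
by rewrite [RHS]tens_add_pi; apply/eqP/tens_eqP; apply: TensDl.
Qed.
Lemma tensDr x y y' : tens x (y + y') = tens x y + tens x y'.
Proof.
by rewrite [RHS]tens_add_pi; apply/eqP/tens_eqP; apply: TensDr.
Qed.
Lemma tens_bal x (b : S) y : tens ((b : S^c) *: x) y = tens x (b *: y).
Proof. by apply/eqP/tens_eqP; apply: TensBal. Qed.

Lemma tens_ind (P : tensor -> Prop) :
  P 0 -> (forall x y t, P t -> P (tens x y + t)) -> forall t, P t.
Proof.
move=> P0 PD t; elim/tens_piW: t => s; rewrite tens_pi.
by elim: s => [|p s IHs]; rewrite ?big_nil // big_cons; apply: PD.
Qed.

Variable G : zmodType.

Definition balanced (m : X -> Y -> G) : Prop :=
  [/\ forall x x' y, m (x + x') y = m x y + m x' y,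
      forall x y y', m x (y + y') = m x y + m x y' &
      forall x (b : S) y, m ((b : S^c) *: x) y = m x (b *: y)].

(* The additive map x (x) y |-> m x y (see [tens_lift_tens]). *)
Definition tens_lift (m : X -> Y -> G) (t : tensor) : G :=
  \sum_(p <- repr t) m p.1 p.2.

Section Lift.
Variables (m : X -> Y -> G) (bal : balanced m).

Lemma tens_lift_pi s : tens_lift m (\pi_tensor s) = \sum_(p <- s) m p.1 p.2.
Proof.
case: bal => mDl mDr mB; rewrite /tens_lift.
move: (repr _) (tens_repr s) => t; elim
  => [u|u v _ ->|u v w _ -> _ ->|s1 t1 s2 t2 _ h _ h'|u v|y|x x' y|x y y'|x b y] //.
- by rewrite !big_cat /= h h'.
- by rewrite !big_cat /= addrC.
- by rewrite big_seq1 big_nil /=; apply: (addrI (m 0 y)); rewrite -mDl !addr0.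
- by rewrite !big_cons !big_nil /= !addr0.
- by rewrite !big_cons !big_nil /= !addr0.
- by rewrite !big_seq1 /= mB.
Qed.

Lemma tens_liftD t u : tens_lift m (t + u) = tens_lift m t + tens_lift m u.
Proof.
elim/tens_piW: t => s; elim/tens_piW: u => t.
by rewrite [_ + _]tens_add_pi !tens_lift_pi big_cat.
Qed.

Lemma tens_lift0 : tens_lift m 0 = 0.
Proof. by apply: (addrI (tens_lift m 0)); rewrite -tens_liftD !addr0. Qed.

Lemma tens_lift_tens x y : tens_lift m (tens x y) = m x y.
Proof. by rewrite tens_lift_pi big_seq1. Qed.

End Lift.
End Tensor.

Section TensorMap.
Variables (S : pzRingType) (X : lmodType S^c) (Y : lmodType S).

Lemma tens_map_balanced (g : {linear Y -> Y}) :
  balanced (fun (x : X) y => tens x (g y)).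
Proof.
split=> [x x' y|x y y'|x b y]; first exact: tensDl.
  by rewrite linearD tensDr.
by rewrite tens_bal linearZ.
Qed.

Definition tens_map (g : {linear Y -> Y}) : tensor X Y -> tensor X Y :=
  tens_lift (fun x y => tens x (g y)).

Lemma tens_map_tens g x y : tens_map g (tens x y) = tens x (g y).
Proof. exact: (tens_lift_tens (tens_map_balanced g)). Qed.
Lemma tens_mapD g t u : tens_map g (t + u) = tens_map g t + tens_map g u.
Proof. exact: (tens_liftD (tens_map_balanced g)). Qed.
Lemma tens_map0 g : tens_map g 0 = 0.
Proof. exact: (tens_lift0 (tens_map_balanced g)). Qed.

End TensorMap.

Section Algebra.
Variables (R : comPzRingType) (A : algebra R).
Implicit Types (M N T U V X Y : lmodType A).

(* M as an R-module. *)
Section Restriction.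
Variable M : lmodType A.

Definition restr : Type := M.
HB.instance Definition _ := GRing.Zmodule.on restr.

Definition restr_scale (r : R) (x : restr) : restr := alg_map A r *: (x : M).

Lemma restr_scaleA r s x : restr_scale r (restr_scale s x) = restr_scale (r * s) x.
Proof. by rewrite /restr_scale scalerA rmorphM. Qed.
Lemma restr_scale1 : left_id 1 restr_scale.
Proof. by move=> x; rewrite /restr_scale rmorph1 scale1r. Qed.
Lemma restr_scaleDr : right_distributive restr_scale +%R.
Proof. by move=> r x y; apply: (@scalerDr _ M). Qed.
Lemma restr_scaleDl x : {morph restr_scale^~ x : r s / r + s}.
Proof. by move=> r s; rewrite /restr_scale rmorphD; apply: (@scalerDl _ M). Qed.

HB.instance Definition _ := GRing.Zmodule_isLmodule.Build R restr
  restr_scaleA restr_scale1 restr_scaleDr restr_scaleDl.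

End Restriction.

(* Hom_A(U, V) as an R-module. *)
Section HomModule.
Variables U V : lmodType A.

Definition homR : Type := {linear U -> V}.
HB.instance Definition _ := GRing.Zmodule.on homR.

Definition homR_fun (r : R) (f : {linear U -> V}) (x : U) : V :=
  alg_map A r *: f x.
Lemma homR_fun_linear r f : linear (homR_fun r f).
Proof.
by move=> a x y; rewrite /homR_fun linearP scalerDr !scalerA alg_central.
Qed.
HB.instance Definition _ r f :=
  GRing.isLinear.Build A U V *:%R (homR_fun r f) (homR_fun_linear r f).

Definition homR_scale (r : R) (f : homR) : homR :=
  homR_fun r f : {linear U -> V}.

Lemma homR_scaleA r s f : homR_scale r (homR_scale s f) = homR_scale (r * s) f.
Proof.
by apply: linear_ext => x; rewrite /= /homR_fun /= /homR_fun scalerA rmorphM.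
Qed.
Lemma homR_scale1 : left_id 1 homR_scale.
Proof.
by move=> f; apply: linear_ext => x; rewrite /= /homR_fun rmorph1 scale1r.
Qed.
Lemma homR_scaleDr : right_distributive homR_scale +%R.
Proof. by move=> r f g; apply: linear_ext => x; apply: scalerDr. Qed.
Lemma homR_scaleDl f : {morph homR_scale^~ f : r s / r + s}.
Proof.
by move=> r s; apply: linear_ext => x; rewrite /= /homR_fun rmorphD; apply: scalerDl.
Qed.

HB.instance Definition _ := GRing.Zmodule_isLmodule.Build R homR
  homR_scaleA homR_scale1 homR_scaleDr homR_scaleDl.

End HomModule.

(* DM = Hom_R(M, R) as a right A-module. *)
Section Dual.
Variable M : lmodType A.

Definition dual : Type := {linear restr M -> R^o}.
HB.instance Definition _ := GRing.Zmodule.on dual.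

Definition dual_fun (a : A) (h : {linear restr M -> R^o}) (x : restr M) : R^o :=
  h (a *: (x : M)).
Lemma dual_fun_linear a h : linear (dual_fun a h).
Proof.
move=> r x y; rewrite /dual_fun -linearP; congr (h _).
rewrite [LHS](@scalerDr _ M) [in LHS](@scalerA _ M).
by rewrite -alg_central -(@scalerA _ M).
Qed.
HB.instance Definition _ a h :=
  GRing.isLinear.Build R (restr M) R^o *:%R (dual_fun a h) (dual_fun_linear a h).

Definition dual_scale (a : A^c) (h : dual) : dual :=
  dual_fun a h : {linear restr M -> R^o}.

Lemma dual_scaleA a b h : dual_scale a (dual_scale b h) = dual_scale (a * b) h.
Proof.
by apply: linear_ext => x; rewrite /= /dual_fun /= /dual_fun (@scalerA _ M).
Qed.
Lemma dual_scale1 : left_id 1 dual_scale.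
Proof.
by move=> h; apply: linear_ext => x; rewrite /= /dual_fun (@scale1r _ M).
Qed.
Lemma dual_scaleDr : right_distributive dual_scale +%R.
Proof. by move=> a g h; apply: linear_ext. Qed.
Lemma dual_scaleDl h : {morph dual_scale^~ h : a b / a + b}.
Proof.
move=> a b; apply: linear_ext => x.
by rewrite /= /dual_fun (@scalerDl _ M) [LHS]linearD.
Qed.

HB.instance Definition _ := GRing.Zmodule_isLmodule.Build A^c dual
  dual_scaleA dual_scale1 dual_scaleDr dual_scaleDl.

End Dual.

Section Bimodule.
Variable Q : lmodType A.

(* Q is a right module over B = End_A(Q)^op by q b = b(q). *)
Definition opend : pzRingType := (endo Q)^c.

(* DQ as a left B-module: (b h)(q) = h(q b) = h(b(q)). *)
Definition dualB : Type := dual Q.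
HB.instance Definition _ := GRing.Zmodule.on dualB.

Definition dualB_fun (b : {linear Q -> Q}) (h : {linear restr Q -> R^o})
  (q : restr Q) : R^o := h (b q).
Lemma dualB_fun_linear b h : linear (dualB_fun b h).
Proof.
by move=> r x y; rewrite /dualB_fun -linearP; congr (h _); apply: (linearP b).
Qed.
HB.instance Definition _ b h :=
  GRing.isLinear.Build R (restr Q) R^o *:%R (dualB_fun b h) (dualB_fun_linear b h).

Definition dualB_scale (b : opend) (h : dualB) : dualB :=
  dualB_fun b h : {linear restr Q -> R^o}.

Lemma dualB_scaleA b c h : dualB_scale b (dualB_scale c h) = dualB_scale (b * c) h.
Proof. by apply: linear_ext. Qed.
Lemma dualB_scale1 : left_id 1 dualB_scale.
Proof. by move=> h; apply: linear_ext. Qed.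
Lemma dualB_scaleDr : right_distributive dualB_scale +%R.
Proof. by move=> b g h; apply: linear_ext. Qed.
Lemma dualB_scaleDl h : {morph dualB_scale^~ h : b c / b + c}.
Proof. by move=> b c; apply: linear_ext => q; apply: (linearD h). Qed.

HB.instance Definition _ := GRing.Zmodule_isLmodule.Build opend dualB
  dualB_scaleA dualB_scale1 dualB_scaleDr dualB_scaleDl.

Lemma dualBZ_linear (b : opend) :
  linear (( *:%R b : dualB -> dualB) : dual Q -> dual Q).
Proof.
move=> a g h; apply: linear_ext => q /=.
congr (g _ + _); exact: esym (linearZ_LR (b : {linear Q -> Q}) a q).
Qed.

Lemma dualAZ_linear (a : A) :
  linear (( *:%R (a : A^c) : dual Q -> dual Q) : dualB -> dualB).
Proof.
move=> b g h; apply: linear_ext => q /=.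
congr (g _ + _); exact: (linearZ_LR (b : {linear Q -> Q}) a q).
Qed.

(* The right action of a on DQ as an endomorphism of the left B-module DQ. *)
Definition dualB_ract (a : A) (h : dualB) : dualB := (a : A^c) *: (h : dual Q).
HB.instance Definition _ a :=
  GRing.isLinear.Build opend dualB dualB *:%R (dualB_ract a) (dualAZ_linear a).

Variable M : lmodType A.

(* Hom_A(DQ, DM), homomorphisms of right A-modules, as a right B-module:
   (f b)(h) = f(b h). *)
Definition homD : Type := {linear dual Q -> dual M}.
HB.instance Definition _ := GRing.Zmodule.on homD.

Definition homD_fun (b : opend) (f : {linear dual Q -> dual M})
  (h : dual Q) : dual M := f (b *: (h : dualB)).
Lemma homD_fun_linear b f : linear (homD_fun b f).
Proof. by move=> a g h; rewrite /homD_fun dualBZ_linear linearP. Qed.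
HB.instance Definition _ b f :=
  GRing.isLinear.Build A^c (dual Q) (dual M) *:%R (homD_fun b f)
    (homD_fun_linear b f).

Definition homD_scale (b : opend^c) (f : homD) : homD :=
  homD_fun b f : {linear dual Q -> dual M}.

Lemma homD_scaleA b c f : homD_scale b (homD_scale c f) = homD_scale (b * c) f.
Proof.
apply: linear_ext => h; rewrite /= /homD_fun /= /homD_fun.
by rewrite (@scalerA _ dualB).
Qed.
Lemma homD_scale1 : left_id 1 homD_scale.
Proof.
by move=> f; apply: linear_ext => h; rewrite /= /homD_fun (@scale1r _ dualB).
Qed.
Lemma homD_scaleDr : right_distributive homD_scale +%R.
Proof. by move=> b f g; apply: linear_ext. Qed.
Lemma homD_scaleDl f : {morph homD_scale^~ f : b c / b + c}.
Proof.
move=> b c; apply: linear_ext => h.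
by rewrite /= /homD_fun (@scalerDl _ dualB) [LHS](linearD f).
Qed.

HB.instance Definition _ := GRing.Zmodule_isLmodule.Build opend^c homD
  homD_scaleA homD_scale1 homD_scaleDr homD_scaleDl.

(* Hom_A(DQ, DM) (x)_B DQ as a right A-module: (f (x) h) a = f (x) (h a). *)
Definition tensD : Type := @tensor opend homD dualB.
HB.instance Definition _ := GRing.Zmodule.on tensD.

Definition tensD_scale (a : A^c) (t : tensD) : tensD := tens_map (dualB_ract a) t.

Lemma tensD_scale_tens a (f : homD) (h : dualB) :
  tensD_scale a (tens f h) = tens f (dualB_ract a h).
Proof. exact: tens_map_tens. Qed.

Lemma tensD_scaleA a b t : tensD_scale a (tensD_scale b t) = tensD_scale (a * b) t.
Proof.
elim/tens_ind: t => [|f h t IHt]; first by rewrite /tensD_scale !tens_map0.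
rewrite {2 3}/tensD_scale !tens_mapD -!/(tensD_scale _ _) -IHt.
rewrite {1}/tensD_scale tens_mapD -!/(tensD_scale _ _) !tensD_scale_tens.
by congr (tens f _ + _); apply: (@scalerA _ (dual Q)).
Qed.
Lemma tensD_scale1 : left_id 1 tensD_scale.
Proof.
elim/tens_ind => [|f h t IHt]; first by rewrite /tensD_scale !tens_map0.
rewrite /tensD_scale tens_mapD -!/(tensD_scale _ _) IHt tensD_scale_tens.
by congr (tens f _ + _); apply: (@scale1r _ (dual Q)).
Qed.
Lemma tensD_scaleDr : right_distributive tensD_scale +%R.
Proof. by move=> a t u; apply: tens_mapD. Qed.
Lemma tensD_scaleDl t : {morph tensD_scale^~ t : a b / a + b}.
Proof.
move=> a b; elim/tens_ind: t => [|f h t IHt].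
  by rewrite /tensD_scale !tens_map0 addr0.
rewrite /tensD_scale !tens_mapD -!/(tensD_scale _ _) IHt !tensD_scale_tens.
rewrite addrACA -tensDr; congr (tens f _ + _).
exact: (@scalerDl _ (dual Q)).
Qed.

HB.instance Definition _ := GRing.Zmodule_isLmodule.Build A^c tensD
  tensD_scaleA tensD_scale1 tensD_scaleDr tensD_scaleDl.

Definition eval_hom (f : homD) (h : dualB) : dual M := (f : {linear _ -> _}) h.

Lemma eval_hom_balanced : @balanced opend homD dualB (dual M) eval_hom.
Proof. by split=> // f h h'; apply: (linearD f). Qed.

(* The morphism f (x) h |-> f(h) (see [chi_tens]). *)
Definition chi_fun : tensD -> dual M := @tens_lift opend homD dualB (dual M) eval_hom.

Lemma chi_fun_tens (f : homD) (h : dualB) : chi_fun (tens f h) = eval_hom f h.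
Proof. exact: tens_lift_tens eval_hom_balanced _ _. Qed.
Lemma chi_funD t u : chi_fun (t + u) = chi_fun t + chi_fun u.
Proof. exact: tens_liftD eval_hom_balanced _ _. Qed.

Lemma chi_fun_linear : linear chi_fun.
Proof.
move=> a t u; rewrite chi_funD; congr (_ + _).
elim/tens_ind: t => [|f h t IHt].
  by rewrite scaler0 /chi_fun (tens_lift0 eval_hom_balanced) scaler0.
rewrite scalerDr !chi_funD scalerDr IHt; congr (_ + _).
rewrite [_ *: _]tensD_scale_tens !chi_fun_tens.
exact: (linearZ_LR (f : {linear dual Q -> dual M})).
Qed.
HB.instance Definition _ :=
  GRing.isLinear.Build A^c tensD (dual M) *:%R chi_fun chi_fun_linear.

Definition chi : {linear tensD -> dual M} := chi_fun.

Lemma chi_tens (f : homD) (h : dualB) : chi (tens f h) = eval_hom f h.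
Proof. exact: chi_fun_tens. Qed.

End Bimodule.

Definition in_add T N : Prop :=
  exists n (N' : lmodType A) (f : {linear (N * N')%type -> {ffun 'I_n -> T}}), bijective f.

Definition precomp X Y T (f : {linear X -> Y}) (g : {linear Y -> T}) :
  {linear X -> T} := g \o f.

Definition AR_mono X Y (f : {linear X -> Y}) : Prop :=
  exists s : {linear restr Y -> restr X}, forall x, s (f x) = x.

Definition left_approx T X N (f : {linear X -> N}) : Prop :=
  in_add T N /\ forall Y, in_add T Y -> surjective (precomp (T := Y) f).

Definition exact_at (U V W : zmodType) (f : U -> V) (g : V -> W) : Prop :=
  forall v, g v = 0 <-> exists u, f u = v.

(* The sequence 0 -> X -> N 0 -> N 1 -> ..., with X in position 0. *)
Definition aug X (N : nat -> lmodType A) (i : nat) : lmodType A :=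
  if i is j.+1 then N j else X.

Definition aug_map X (N : nat -> lmodType A) (e : {linear X -> N 0%N})
    (d : forall i, {linear N i -> N i.+1}) (i : nat) :
    {linear aug X N i -> aug X N i.+1} :=
  if i is j.+1 then d j else e.

Section Sequences.
Variables (C : nat -> lmodType A) (d : forall i, {linear C i -> C i.+1}).

(* Exactness of 0 -> C 0 -> ... -> C n; there is no condition at C n. *)
Definition exact_seq n : Prop :=
  ((0 < n)%N -> injective (d 0%N)) /\
  forall i, (i.+1 < n)%N -> exact_at (d i) (d i.+1).

(* The complex 0 -> C 0 -> ... -> C n is split over R: every differential d
   satisfies d s d = d for some R-linear s.  For n = 1 and an exact sequence this
   says that C 0 -> C 1 is split injective over R. *)
Definition split_seq n : Prop :=
  forall i, (i < n)%N ->
    exists s : {linear restr (C i.+1) -> restr (C i)},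
      forall x, d i (s (d i x)) = d i x.

Definition AR_exact_seq n : Prop := exact_seq n /\ split_seq n.

(* Exactness of Hom(C n, T) -> ... -> Hom(C 0, T) -> 0. *)
Definition hom_exact_seq T n : Prop :=
  ((0 < n)%N -> surjective (precomp (T := T) (d 0%N))) /\
  forall i, (i.+1 < n)%N ->
    exact_at (precomp (T := T) (d i.+1)) (precomp (T := T) (d i)).

End Sequences.

(* There is 0 -> X -> T_1 -> ... -> T_n as in the definition of the relative
   dominant dimension, with T_(i+1) = N i; the values of N and d from n on are
   irrelevant.  The case n = 0 holds trivially, which does not affect the supremum
   in [domdim], taken only when the case n = 1 holds. *)
Definition has_coresolution T X n : Prop :=
  exists (N : nat -> lmodType A) (e : {linear X -> N 0%N})
         (d : forall i, {linear N i -> N i.+1}),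
    [/\ forall i, (i < n)%N -> in_add T (N i),
        AR_exact_seq (aug_map e d) n &
        hom_exact_seq (aug_map e d) T n].

End Algebra.

Variant enat : Type := Fin of nat | Infty.

Definition enat_le (x y : enat) : Prop :=
  match x, y with
  | _, Infty => True
  | Infty, Fin _ => False
  | Fin m, Fin n => (m <= n)%N
  end.

Definition ubnd (S : nat -> Prop) (k : nat) : bool :=
  `[< forall n, S n -> (n <= k)%N >].

Definition enat_sup (S : nat -> Prop) : enat :=
  if pselect (exists k, ubnd S k) is left h then Fin (ex_minn h) else Infty.

Lemma enat_supP (S : nat -> Prop) (y : enat) :
  enat_le (enat_sup S) y <-> forall n, S n -> enat_le (Fin n) y.
Proof.
rewrite /enat_sup; case: pselect => [h|nh].
  case: ex_minnP => m /asboolP ubm minm; case: y => [k|] //=; split=> [mk n Sn|ubk].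
    exact: leq_trans (ubm n Sn) mk.
  by apply: minm; apply/asboolP.
case: y => [k|] //=; split=> // ubk; apply: nh.
by exists k; apply/asboolP.
Qed.

Definition domdim (R : comPzRingType) (A : algebra R) (T X : lmodType A) : enat :=
  if pselect (exists (N : lmodType A) (f : {linear X -> N}),
                left_approx T f /\ AR_mono f)
  then enat_sup (has_coresolution T X)
  else Fin 0.

(* Main.v *)
Require Import Defs.
From mathcomp Require Import all_boot all_algebra.
From HB Require Import structures.
From mathcomp Require Import boolp.

(** Since [Q] is finitely generated projective over [R], it is reflexive, so every right
    [A]-linear map [DQ -> DM] is [Dg] for some [g : M -> Q] ([pull_surjective]), and [chi]
    sends [Dg (x) h] to the functional [h \o g] on [M].

    Let [e : M -> Q^n] collect generators of the [R]-module [Hom_A(M, Q)], which is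
    finitely generated because [R] is Noetherian ([approx_killing]); [e] is a left
    approximation.  The image of [chi] then consists of the functionals [psi \o e] with
    [psi] in [D(Q^n)], and applying this to the coordinates of a dual basis of [M] shows
    that [chi] is surjective exactly when such an [e] splits over [R]
    ([dual_basis_factor]).  Conversely, a functional on [M] extends along any split
    approximation, and decomposes along the projections to [Q].

    For the second equivalence, suppose first that [0 -> M -> N -> N1] is a coresolution,
    with maps [e] and [d].  A tensor [t] over [M] can be rewritten from a functional [psi]
    on [N] with [chi t = psi \o e] ([chi_expand]).  If [chi t = 0], then [psi] factors
    through [d], and as [d \o e = 0] this forces [t = 0]
    ([chi_injective_of_presentation]).  Suppose now that [chi] is bijective, and let
    [d : Q^n -> Q^m] collect generators of the maps [Q^n -> Q] that vanish on the image of
    [e].  Right exactness of the tensor product, in the form of [tens_sum_mod], shows that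
    every functional on [Q^n] vanishing on the image of [e] factors through [d]
    ([dual_exact]).  If [r] is an [R]-linear retraction of [e], the coordinates of
    [id - e \o r] are such functionals, so [id - e \o r = s \o d] for some [R]-linear [s].
    This one equation gives exactness at [Q^n] and the splitting of [d]. *)

Set Implicit Arguments.
Unset Strict Implicit.
Unset Printing Implicit Defensive.

Import GRing.Theory.
Local Open Scope ring_scope.

(** * Linear maps on finite powers of a module *)

Section LinearMaps.
Variable S : pzRingType.
Implicit Types U V W : lmodType S.

(** The function [f], bundled as a linear map by a proof of its linearity. *)
Definition lmap U V (f : U -> V) (_ : linear f) : U -> V := f.
HB.instance Definition _ U V (f : U -> V) (fl : linear f) :=
  GRing.isLinear.Build S U V *:%R (lmap fl) fl.

Fact ffun_proj_linear V n (j : 'I_n) : linear (fun x : {ffun 'I_n -> V} => x j).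
Proof. by move=> a x y; rewrite !ffunE. Qed.
Definition ffun_proj {V n} (j : 'I_n) : {linear {ffun 'I_n -> V} -> V} :=
  lmap (@ffun_proj_linear V n j).

Fact ffun_inj_linear V n (j : 'I_n) :
  linear (fun v : V => [ffun i : 'I_n => if i == j then v else 0]).
Proof.
move=> a x y; apply/ffunP => i; rewrite !ffunE.
by case: eqP => // _; rewrite scaler0 addr0.
Qed.
Definition ffun_inj {V n} (j : 'I_n) : {linear V -> {ffun 'I_n -> V}} :=
  lmap (@ffun_inj_linear V n j).

Lemma ffun_sum_inj V n (x : {ffun 'I_n -> V}) :
  \sum_j ffun_inj j (ffun_proj j x) = x.
Proof.
apply/ffunP => i; rewrite sum_ffunE (bigD1 i) //= ffunE eqxx big1 ?addr0 //.
by move=> j /negPf ji; rewrite ffunE eq_sym ji.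
Qed.

Fact ffun_tuple_linear U V n (g : 'I_n -> {linear U -> V}) :
  linear (fun x => [ffun j => g j x]).
Proof. by move=> a x y; apply/ffunP => i; rewrite !ffunE linearP. Qed.
Definition ffun_tuple U V n (g : 'I_n -> {linear U -> V}) :
  {linear U -> {ffun 'I_n -> V}} := lmap (ffun_tuple_linear g).

Fact lsum_linear U V (I : finType) (g : I -> {linear U -> V}) :
  linear (fun x => \sum_j g j x).
Proof.
move=> a x y; rewrite scaler_sumr -big_split; apply: eq_bigr => j _.
exact: linearP.
Qed.
Definition lsum U V (I : finType) (g : I -> {linear U -> V}) : {linear U -> V} :=
  lmap (lsum_linear g).

Lemma span_enum (I : finType) V (g : I -> V) (c : I -> S) :
  \sum_i c i *: g i = \sum_(k < #|I|) c (enum_val k) *: g (enum_val k).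
Proof. by rewrite (reindex _ (onW_bij _ (enum_val_bij I))). Qed.

Lemma fin_gen_finType (I : finType) V (g : I -> V) :
  (forall x, exists c : I -> S, x = \sum_i c i *: g i) -> fin_gen V.
Proof.
move=> gP; exists #|I|, (fun k => g (enum_val k)) => x.
have [c ->] := gP x; exists (fun k => c (enum_val k)); exact: span_enum.
Qed.

Lemma fin_gen_ffun V n : fin_gen V -> fin_gen {ffun 'I_n -> V}.
Proof.
case=> m [g gP].
apply: (@fin_gen_finType ('I_n * 'I_m)%type _
  (fun k => ffun_inj k.1 (g k.2))) => x.
have [c cP] := choice (fun j : 'I_n => gP (x j)).
exists (fun k => c k.1 k.2).
rewrite -(pair_bigA _ (fun j i => c j i *: ffun_inj j (g i))) /=.
rewrite -[LHS]ffun_sum_inj; apply: eq_bigr => j _.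
have -> : ffun_proj j x = \sum_i c j i *: g i := cP j.
by rewrite linear_sum; apply: eq_bigr => i _; rewrite linearZ.
Qed.
End LinearMaps.

(** * Submodules over a Noetherian ring and dual bases *)

Section Noetherian.
Variable R : comPzRingType.
Implicit Types U V W : lmodType R.

(** Submodules of [V] are predicates, since membership need not be decidable. *)
Definition submodule V (W : V -> Prop) : Prop :=
  W 0 /\ forall a x y, W x -> W y -> W (a *: x + y).

(** Induction on the number of generators: the coefficients of [v ord0] in the elements
    of [W] form an ideal, and finitely many elements of [W] realize its generators;
    subtracting a combination of them moves an element of [W] into the span of the
    other [v i]. *)
Lemma noetherian_span V (W : V -> Prop) n (v : 'I_n -> V) :
  noetherian R -> submodule W ->
  (forall x, W x -> exists c : 'I_n -> R, x = \sum_i c i *: v i) ->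
  exists (I : finType) (g : I -> V), (forall i, W (g i)) /\
    forall x, W x -> exists c : I -> R, x = \sum_i c i *: g i.
Proof.
move=> Rn; elim: n W v => [|n IHn] W v [W0 WP] Wv.
  exists 'I_0, v; split=> [[]//|x /Wv [c ->]]; exists c; exact: erefl.
pose span x := exists c : 'I_n -> R, x = \sum_i c i *: v (lift ord0 i).
have span0 : span 0.
  by exists (fun=> 0); rewrite big1 // => i _; rewrite scale0r.
have spanP a x y : span x -> span y -> span (a *: x + y).
  move=> [c ->] [c' ->]; exists (fun i => a * c i + c' i).
  rewrite scaler_sumr -big_split; apply: eq_bigr => i _.
  by rewrite scalerDl scalerA.
pose lead c := exists2 x, span x & W (c *: v ord0 + x).
have [|k [a aP]] := Rn lead.
  split=> [|c c' [x sx Wx] [x' sx' Wx']|b c [x sx Wx]].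
  - by exists 0; rewrite // scale0r addr0.
  - exists (x + x'); first by rewrite -[x]scale1r; apply: (spanP).
    by rewrite scalerDl addrACA -[X in X + _]scale1r; apply: (WP).
  - exists (b *: x); first by rewrite -[_ *: x]addr0; apply: (spanP).
    by rewrite -scalerA -scalerDr -[_ *: (_ + _)]addr0; apply: (WP).
have leada j : lead (a j).
  apply/aP; exists (fun i => (i == j)%:R).
  rewrite (bigD1 j) //= eqxx mul1r big1 ?addr0 // => i /negPf ->.
  by rewrite mul0r.
have [t tP] := choice (fun j => let: ex_intro2 x sx Wx := leada j in
  ex_intro (fun x => span x /\ W (a j *: v ord0 + x)) x (conj sx Wx)).
have subW (c : 'I_k -> R) : W (\sum_j c j *: (a j *: v ord0 + t j)).
  elim/big_rec: _ => // j x _; apply: (WP); exact: (tP j).2.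
have [||I [g [Wg gP]]] := IHn (fun x => W x /\ span x) (fun i => v (lift ord0 i)).
- by split=> // b x y [Wx sx] [Wy sy]; split; [apply: (WP) | apply: (spanP)].
- by move=> x [].
exists ('I_k + I)%type,
  (fun s => match s with inl j => a j *: v ord0 + t j | inr i => g i end).
split=> [[j|i]|x Wx]; [exact: (tP j).2 | exact: (Wg i).1 |].
have [c xE] := Wv x Wx; rewrite big_ord_recl in xE.
have [|b bE] := (aP (c ord0)).1.
  exists (\sum_(i < n) c (lift ord0 i) *: v (lift ord0 i)); last by rewrite -xE.
  by exists (fun i => c (lift ord0 i)).
pose w := \sum_j b j *: (a j *: v ord0 + t j).
have [|c' c'E] := gP (- 1 *: w + x).
  split; first by apply: (WP) => //; apply: subW.
  have -> : w = c ord0 *: v ord0 + \sum_j b j *: t j.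
    rewrite bE scaler_suml -big_split; apply: eq_bigr => j _.
    by rewrite scalerDr scalerA.
  rewrite xE scalerDr scaleN1r addrACA addNr add0r.
  apply: (spanP); last by exists (fun i => c (lift ord0 i)).
  apply: (@big_ind _ span) => // [x' y' sx' sy'|j _].
    by rewrite -[x']scale1r; apply: (spanP).
  by rewrite -[_ *: _]addr0; apply: (spanP) => //; exact: (tP j).1.
exists (fun s => match s with inl j => b j | inr i => c' i end).
by rewrite big_sumType /= -c'E -/w scaleN1r addrA addrN add0r.
Qed.

(** The submodules of any module that embeds into a finitely generated one. *)
Lemma noetherian_inj U V (phi : {linear U -> V}) (W : U -> Prop) :
  noetherian R -> fin_gen V -> injective phi -> submodule W ->
  exists n (g : 'I_n -> U), (forall i, W (g i)) /\
    forall x, W x -> exists c : 'I_n -> R, x = \sum_i c i *: g i.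
Proof.
move=> Rn [n [v vP]] phi_inj [W0 WP].
pose W' y := exists2 x, W x & phi x = y.
have [||I [g [Wg gP]]] := @noetherian_span V W' n v Rn.
- split; first by exists 0; rewrite ?linear0.
  move=> a _ _ [x Wx <-] [y Wy <-]; exists (a *: x + y); first exact: WP.
  exact: linearP.
- by move=> x _; apply: vP.
have [h hP] := choice (fun i => let: ex_intro2 x Wx e := Wg i in
  ex_intro (fun x => W x /\ phi x = g i) x (conj Wx e)).
exists #|I|, (fun k => h (enum_val k)); split=> [i|x Wx]; first exact: (hP _).1.
have [|c cE] := gP (phi x); first by exists x.
exists (fun k => c (enum_val k)); rewrite -span_enum; apply: phi_inj.
rewrite cE linear_sum; apply: eq_bigr => i _; by rewrite linearZ (hP i).2.
Qed.

(** The family [v] together with its coordinate functionals [f]; no uniqueness of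
    coordinates is required, so this characterizes finitely generated projective
    modules rather than free ones. *)
Definition dual_basis V (I : finType) (v : I -> V) (f : I -> {linear V -> R^o}) :=
  forall x, x = \sum_i (f i x : R) *: v i.

Fact comb_linear V n (v : 'I_n -> V) :
  linear (fun c : {ffun 'I_n -> R^o} => \sum_i (c i : R) *: v i).
Proof.
move=> a x y; rewrite scaler_sumr -big_split; apply: eq_bigr => i _.
by rewrite !ffunE scalerDl scalerA.
Qed.

Lemma fg_projective_dual_basis V : fg_projective V ->
  exists n (v : 'I_n -> V) (f : 'I_n -> {linear V -> R^o}), dual_basis v f.
Proof.
case=> [[n [v vP]] projV].
have [|s sP] := projV _ _ (lmap (comb_linear v)) (idfun : {linear V -> V}).
  move=> x; have [c ->] := vP x; exists (finfun c).
  by apply: eq_bigr => i _; rewrite ffunE.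
exists n, v, (fun i => ffun_proj i \o s) => x.
by rewrite -[LHS](sP x).
Qed.

Fact rank_one_linear V W (th : {linear V -> R^o}) (w : W) :
  linear (fun x => (th x : R) *: w).
Proof. by move=> a x y; rewrite linearP scalerDl scalerA. Qed.

(** A map [p] into a module with a dual basis factors through [d] as soon as all its
    coordinates do.  Both the retraction of an
    approximation and the splitting of the next map are obtained this way. *)
Lemma dual_basis_factor U V W (I : finType) (v : I -> V) f
    (p : {linear U -> V}) (d : {linear U -> W}) :
  dual_basis v f ->
  (forall i, exists th : {linear W -> R^o}, forall x, f i (p x) = th (d x)) ->
  exists s : {linear W -> V}, forall x, s (d x) = p x.
Proof.
move=> vf /choice [th thP].
exists (lsum (fun i => lmap (rank_one_linear (th i) (v i)))) => x.
by rewrite [RHS]vf; apply: eq_bigr => i _; rewrite thP.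
Qed.
End Noetherian.

(** * A vanishing criterion for tensors *)

(** If [m] is biadditive and balanced modulo a subgroup [L], then a vanishing sum of
    pure tensors has its image under [m] in [L].  This is the universal property of the
    tensor product with values in the quotient of [G] by [L], without the quotient. *)
Lemma tens_sum_mod (S : pzRingType) (X : lmodType S^c) (Y : lmodType S) (G : zmodType)
    (L : G -> Prop) (m : X -> Y -> G) :
    L 0 -> (forall x y, L x -> L y -> L (x - y)) ->
    (forall x x' y, L (m (x + x') y - (m x y + m x' y))) ->
    (forall x y y', L (m x (y + y') - (m x y + m x y'))) ->
    (forall x (b : S) y, L (m ((b : S^c) *: x) y - m x (b *: y))) ->
  forall s : seq (X * Y), \sum_(p <- s) tens p.1 p.2 = 0 ->
    L (\sum_(p <- s) m p.1 p.2).
Proof.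
move=> L0 LB LDl LDr Lbal s.
have LN x : L x -> L (- x) by rewrite -sub0r; apply: LB.
have LD x y : L x -> L y -> L (x + y).
  by move=> Lx Ly; rewrite -[y]opprK; apply: LB => //; apply: LN.
rewrite -tens_pi -[0]/(\pi_(tensor X Y)%qT [::]) => /eqP/tens_eqP st.
suff : L (\sum_(p <- s) m p.1 p.2 - \sum_(p <- [::]) m p.1 p.2).
  by rewrite big_nil subr0.
elim: st => {s}
  [u|u v _ h|u v w _ h _ h'|s1 t1 s2 t2 _ h _ h'|u v|y|x x' y|x y y'|x b y].
- by rewrite subrr.
- by rewrite -opprB; apply: LN.
- by rewrite -(subrKA (\sum_(p <- v) m p.1 p.2)); apply: LD.
- by rewrite !big_cat opprD addrACA; apply: LD.
- by rewrite !big_cat /= addrC subrr.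
- rewrite big_seq1 big_nil subr0 /=.
  have := LDl 0 0 y; rewrite addr0 opprD addrA subrr sub0r => /LN.
  by rewrite opprK.
- by rewrite big_seq1 !big_cons big_nil /= addr0.
- by rewrite big_seq1 !big_cons big_nil /= addr0.
- rewrite !big_seq1; exact: Lbal.
Qed.

(** * Duality over the base ring *)

Section Algebra.
Variables (R : comPzRingType) (A : algebra R).
Implicit Types M N Q X Y : lmodType A.

Fact restr_map_linear M N (g : {linear M -> N}) :
  linear (g : restr M -> restr N).
Proof. by move=> r x y; apply: linearP. Qed.
(** An [A]-linear map as an [R]-linear one. *)
Definition restr_map M N (g : {linear M -> N}) : {linear restr M -> restr N} :=
  lmap (restr_map_linear g).

(** Evaluation of a functional; it spares the conversion from [dual M], which carries
    the structure of a right [A]-module, to the linear maps on [restr M]. *)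
Definition dapp M (h : dual M) (x : M) : R :=
  (h : {linear restr M -> R^o}) x.

Lemma dual_ext M (h h' : dual M) : dapp h =1 dapp h' -> h = h'.
Proof. by move=> hh'; apply: linear_ext. Qed.

Lemma dapp_sum M I (s : seq I) (h : I -> dual M) x :
  dapp (\sum_(i <- s) h i) x = \sum_(i <- s) dapp (h i) x.
Proof. exact: (big_morph (fun h : dual M => dapp h x)). Qed.

Lemma dappD M (h : dual M) x y : dapp h (x + y) = dapp h x + dapp h y.
Proof. exact: (linearD (h : {linear restr M -> R^o})). Qed.

Lemma dappB M (h : dual M) x y : dapp h (x - y) = dapp h x - dapp h y.
Proof. exact: (linearB (h : {linear restr M -> R^o})). Qed.

Lemma dapp0 M (h : dual M) : dapp h 0 = 0.
Proof. exact: (linear0 (h : {linear restr M -> R^o})). Qed.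

Lemma dapp_sumr M I (s : seq I) (h : dual M) (x : I -> M) :
  dapp h (\sum_(i <- s) x i) = \sum_(i <- s) dapp h (x i).
Proof. exact: (linear_sum (h : {linear restr M -> R^o})). Qed.

Lemma dappZ M (h : dual M) (r : R) x : dapp h (alg_map A r *: x) = r * dapp h x.
Proof. exact: (linearZ_LR (h : {linear restr M -> R^o})). Qed.

(** Precomposition of functionals with an [R]-linear map. *)
Definition rpull M N (g : {linear restr M -> restr N}) (h : dual N) : dual M :=
  ((h : {linear restr N -> R^o}) \o g : {linear restr M -> R^o}).

Fact pull_linear M N (g : {linear M -> N}) : linear (rpull (restr_map g)).
Proof.
move=> a h h'; apply: dual_ext => x.
congr (dapp h _ + _); apply: esym; exact: (linearZ_LR g).
Qed.
(** [Dg : DN -> DM], as a map of right [A]-modules. *)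
Definition pull M N (g : {linear M -> N}) : {linear dual N -> dual M} :=
  lmap (pull_linear g).

Lemma dapp_pull M N (g : {linear M -> N}) h x : dapp (pull g h) x = dapp h (g x).
Proof. by []. Qed.

Lemma dapp_comb M (I : finType) (c : I -> R) (v : I -> restr M) (h : dual M) :
  dapp h (\sum_i c i *: v i) = \sum_i c i * dapp h (v i).
Proof.
rewrite [LHS](linear_sum (h : {linear restr M -> R^o})); apply: eq_bigr => i _.
exact: (linearZ_LR (h : {linear restr M -> R^o})).
Qed.

Lemma dual_separates Q (x : Q) :
  fg_projective (restr Q) -> (forall h : dual Q, dapp h x = 0) -> x = 0.
Proof.
move=> /fg_projective_dual_basis[n [v [f vf]]] x0.
rewrite (vf x : x = _); apply: big1 => i _.
have -> : f i x = 0 := x0 (f i).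
exact: (@scale0r _ (restr Q)).
Qed.

(** [Hom_A(M, Q) -> Hom_A(DQ, DM)] is onto because [Q] is reflexive over [R]; nothing is
    required of [M]. *)
Lemma pull_surjective Q M : fg_projective (restr Q) ->
  surjective (@pull M Q).
Proof.
move=> Qp f; have [n [v [b vb]]] := fg_projective_dual_basis Qp.
(* g(x) is the element of Q that represents h |-> f(h)(x) in the bidual. *)
pose g (x : M) : Q := \sum_i dapp (f (b i)) x *: v i.
have gP h x : dapp h (g x) = dapp (f h) x.
  have hE : h = \sum_i (alg_map A (dapp h (v i)) : A^c) *: (b i : dual Q).
    apply: dual_ext => y.
    rewrite dapp_sum (vb y : y = _) dapp_comb -(vb y : y = _).
    by apply: eq_bigr => i _; rewrite mulrC; apply/esym/dappZ.
  (* f is R-linear, so it may be computed on the coordinates of h. *)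
  rewrite /g dapp_comb {2}hE linear_sum dapp_sum; apply: eq_bigr => i _.
  rewrite linearZ mulrC; exact/esym/dappZ.
have g_lin : linear g.
  move=> a x y; apply/eqP; rewrite -subr_eq0; apply/eqP.
  apply: dual_separates Qp _ => h.
  rewrite dappB dappD !gP.
  have -> : dapp h (a *: g x) = dapp ((a : A^c) *: h) (g x) by [].
  rewrite gP linearZ dappD.
  by rewrite subrr.
by exists (lmap g_lin); apply: linear_ext => h; apply: dual_ext => x; exact: gP.
Qed.

Lemma dual_basis_ffun Q n : fg_projective (restr Q) ->
  exists (J : finType) (w : J -> restr {ffun 'I_n -> Q}) f, dual_basis w f.
Proof.
move=> /fg_projective_dual_basis[m [v [f vf]]].
exists ('I_n * 'I_m)%type, (fun k => ffun_inj k.1 (v k.2 : Q)).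
exists (fun k => f k.2 \o restr_map (ffun_proj k.1)) => x.
rewrite -[LHS](@ffun_sum_inj _ Q n).
rewrite -(pair_bigA _ (fun j i =>
  (f i (x j) : R) *: (ffun_inj j (v i : Q) : restr {ffun 'I_n -> Q}))) /=.
apply: eq_bigr => j _.
have -> : ffun_proj j x = \sum_i (f i (x j) : R) *: v i := vf (x j).
rewrite (linear_sum (restr_map (ffun_inj j))); apply: eq_bigr => i _.
exact: (linearZ_LR (restr_map (ffun_inj j))).
Qed.

(** * Retracts of finite powers and approximations *)

(** [i] and [p] exhibit [N] as a direct summand of the [n]-th power of [Q]. *)
Definition retraction Q N n (i : 'I_n -> {linear N -> Q})
    (p : 'I_n -> {linear Q -> N}) :=
  forall x, \sum_j p j (i j x) = x.

Lemma in_add_retraction Q N : in_add Q N ->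
  exists n (i : 'I_n -> {linear N -> Q}) (p : 'I_n -> {linear Q -> N}),
    retraction i p.
Proof.
case=> n [N' [f [f' fK f'K]]].
have f'l : linear f' by move=> a x y; apply: (can_inj fK); rewrite linearP !f'K.
have il : linear (fun x : N => (x, 0) : (N * N')%type).
  by move=> a x y; congr pair; rewrite /= scaler0 addr0.
exists n, (fun j => ffun_proj j \o (f \o lmap il)).
exists (fun j => (fst : {linear _ -> _}) \o (lmap f'l \o ffun_inj j)) => x.
rewrite -(linear_sum (fst : {linear (N * N')%type -> N})) /=.
rewrite -(linear_sum (lmap f'l)) (ffun_sum_inj (f (lmap il x))).
by rewrite /= /lmap fK.
Qed.

Lemma in_add_ffun Q n : in_add Q {ffun 'I_n -> Q}.
Proof.
exists n, {ffun 'I_0 -> Q}, (fst : {linear _ -> _}).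
exists (fun x => (x, 0)) => //= -[x y] /=; congr pair.
by apply/ffunP => -[].
Qed.

(** It suffices to test left approximations against [Q] itself. *)
Lemma left_approx_add Q M N (e : {linear M -> N}) :
  in_add Q N -> surjective (precomp (T := Q) e) -> left_approx Q e.
Proof.
move=> QN eQ; split=> // Y /in_add_retraction[n [i [p ip]]] g.
have [c cP] := choice (fun j => eQ (i j \o g)).
exists (lsum (fun j => p j \o c j)); apply: linear_ext => x.
rewrite -[RHS](ip (g x)); apply: eq_bigr => j _.
congr (p j _); exact: (congr1 (fun k : {linear M -> Q} => k x) (cP j)).
Qed.

Fact eval_linear Q X n (x : 'I_n -> X) :
  linear (fun phi : homR X Q =>
    [ffun k => (phi : {linear X -> Q}) (x k)] : {ffun 'I_n -> restr Q}).
Proof. by move=> r f g; apply/ffunP => k; rewrite !ffunE. Qed.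

(** A left approximation of the cokernel of [e], described as a map [d] out of [X] so as
    not to form the cokernel: the maps [X -> Q] that vanish on the image of [e] form a
    finitely generated [R]-module, and [d] collects generators of it.  For [e = 0] this is
    a left approximation of [X]. *)
Lemma approx_killing Q M X (e : {linear M -> X}) :
  noetherian R -> fin_gen X -> fin_gen (restr Q) ->
  exists n (d : {linear X -> {ffun 'I_n -> Q}}), (forall x, d (e x) = 0) /\
    forall phi : {linear X -> Q}, (forall x, phi (e x) = 0) ->
      exists g, precomp d g = phi.
Proof.
move=> Rn [m [v vP]] Qf.
have [|||n [g [ge gP]]] := @noetherian_inj _ (homR X Q) _ (lmap (eval_linear v))
   (fun phi => forall x, (phi : {linear X -> Q}) (e x) = 0) Rn.
- exact: fin_gen_ffun.
- move=> f f' ff'; apply: linear_ext => x; have [c ->] := vP x.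
  rewrite !linear_sum; apply: eq_bigr => i _; rewrite !linearZ; congr (_ *: _).
  by have := congr1 (fun k : {ffun 'I_m -> restr Q} => k i) ff'; rewrite !ffunE.
- split=> // r f f' f0 f'0 x.
  have -> : (r *: f + f' : homR X Q) = (homR_scale r f + f' : {linear X -> Q}) by [].
  by rewrite homDE f'0 addr0 /= /homR_fun f0 scaler0.
exists n, (ffun_tuple g); split=> [x|phi phi0].
  by apply/ffunP => i; rewrite !ffunE ge.
have [c cE] := gP phi phi0.
exists (lsum (fun j =>
  (homR_scale (c j) (idfun : {linear Q -> Q}) : {linear Q -> Q}) \o ffun_proj j)).
apply: linear_ext => x; rewrite cE.
rewrite (big_morph (fun k : homR X Q => (k : {linear X -> Q}) x)
           (id1 := 0) (op1 := +%R)) //.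
by apply: eq_bigr => j _; rewrite /= /homR_fun /= /lmap ffunE.
Qed.
Lemma retraction_ffun Q n :
  retraction (fun j => ffun_proj j : {linear {ffun 'I_n -> Q} -> Q})
             (fun j => ffun_inj j).
Proof. exact: ffun_sum_inj. Qed.

(** * Pure tensors of the evaluation map *)

(** The element [Dg (x) h] of [Hom_A(DQ, DM) (x)_B DQ]; by [pull_surjective] these
    elements are all the pure tensors when [Q] is finitely generated projective over
    [R]. *)
Definition ptens Q M (g : {linear M -> Q}) (h : dual Q) : tensD Q M :=
  @tens (opend Q) (homD Q M) (dualB Q) (pull g) h.

Lemma chi_ptens Q M (g : {linear M -> Q}) h : chi Q M (ptens g h) = pull g h.
Proof. exact: chi_tens. Qed.

Lemma pull_comp M N X (f : {linear N -> X}) (g : {linear M -> N}) h :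
  pull (f \o g) h = pull g (pull f h).
Proof. exact: dual_ext. Qed.

Lemma pull_endo Q (c : {linear Q -> Q}) h :
  (pull c h : dualB Q) = dualB_scale c h.
Proof. exact: dual_ext. Qed.

(** Endomorphisms of [Q] move across the tensor sign. *)
Lemma ptens_comp Q M (c : {linear Q -> Q}) (g : {linear M -> Q}) h :
  ptens (c \o g) h = ptens g (pull c h).
Proof.
have cE : (pull (c \o g) : homD Q M) = homD_scale c (pull g).
  by apply: linear_ext => k; apply: dual_ext.
rewrite /ptens pull_endo cE; exact: (@tens_bal (opend Q) (homD Q M) (dualB Q)).
Qed.

Lemma ptens_sum Q M n (g : 'I_n -> {linear M -> Q}) h :
  ptens (lsum g) h = \sum_j ptens (g j) h.
Proof.
have -> : ptens (lsum g) h =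
    @tens (opend Q) (homD Q M) (dualB Q) (\sum_j (pull (g j) : homD Q M)) h.
  rewrite /ptens; congr tens; apply: linear_ext => k; apply: dual_ext => x.
  rewrite (big_morph (fun u : homD Q M => (u : {linear dual Q -> dual M}) k)
             (id1 := 0) (op1 := +%R)) //.
  by rewrite dapp_sum dapp_pull [LHS]dapp_sumr.
elim/big_ind2: _ => // [|x1 x2 y1 y2 <- <-]; last exact: tensDl.
apply: (addrI (@tens (opend Q) (homD Q M) (dualB Q) 0 h)).
by rewrite -tensDl !addr0.
Qed.

Lemma ptensDr Q M (g : {linear M -> Q}) h h' :
  ptens g (h + h') = ptens g h + ptens g h'.
Proof. exact: tensDr. Qed.

Lemma ptens0 Q M (g : {linear M -> Q}) : ptens g 0 = 0.
Proof. by apply: (addrI (ptens g 0)); rewrite -ptensDr !addr0. Qed.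

Lemma ptens_sumr Q M I (s : seq I) (g : {linear M -> Q}) (h : I -> dual Q) :
  ptens g (\sum_(i <- s) h i) = \sum_(i <- s) ptens g (h i).
Proof. exact: (big_morph (ptens g) (ptensDr g) (ptens0 g)). Qed.

(** If [e] is a left approximation by a retract [N] of a power of [Q], every tensor [t]
    over [M] is determined by a functional [psi] on [N] that extends [chi t] along [e]:
    each map [M -> Q] is [c \o e], and [c] is the sum of the [(c \o p j) \o i j], whose
    endomorphism part [c \o p j] moves across the tensor sign. *)
Lemma chi_expand Q M N n (i : 'I_n -> {linear N -> Q})
    (p : 'I_n -> {linear Q -> N}) (e : {linear M -> N}) :
  fg_projective (restr Q) -> retraction i p -> surjective (precomp (T := Q) e) ->
  forall t : tensD Q M, exists psi : dual N,
    chi Q M t = pull e psi /\ t = \sum_j ptens (i j \o e) (pull (p j) psi).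
Proof.
move=> Qp ip eQ; apply: tens_ind => [|f h t [psi [chit tE]]].
  exists 0; rewrite !linear0; split=> //; rewrite big1 // => j _.
  by rewrite linear0 ptens0.
have [g gf] := pull_surjective Qp f; have [c cg] := eQ g.
exists (pull c h + psi); split.
  rewrite linearD chit linearD; congr (_ + _).
  by rewrite [LHS]chi_tens -pull_comp /eval_hom -gf -cg.
rewrite tE.
have -> : tens f h = \sum_j ptens (i j \o e) (pull (p j) (pull c h)).
  have -> : tens f h = ptens (lsum (fun j => (c \o p j) \o (i j \o e))) h.
    rewrite /ptens -gf; congr tens; congr pull.
    rewrite -cg; apply: linear_ext => x; rewrite /= -{1}(ip (e x)).
    by rewrite linear_sum.
  by rewrite ptens_sum; apply: eq_bigr => j _; rewrite ptens_comp -pull_comp.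
rewrite -big_split; apply: eq_bigr => j _.
by rewrite linearD ptensDr.
Qed.

Lemma chi_surjective_of_approx Q M : fg_projective (restr Q) ->
  (exists (N : lmodType A) (e : {linear M -> N}), left_approx Q e /\ AR_mono e) ->
  surjective (chi Q M).
Proof.
move=> Qp [N [e [[/in_add_retraction[n [i [p ip]]] _] [s se]]]] h.
pose psi := rpull s h.
exists (\sum_j ptens (i j \o e) (pull (p j) psi)).
rewrite linear_sum; apply: dual_ext => x.
rewrite dapp_sum (eq_bigr (fun j => dapp psi (p j (i j (e x))))).
  by rewrite -dapp_sumr ip /dapp /= se.
by move=> j _; rewrite chi_ptens.
Qed.

(** If [chi t = 0], the functional [psi] of [chi_expand] vanishes on the image of [e],
    hence factors through [d]; moving [d] across the tensor sign turns [t] into tensors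
    whose first factors pass through [d \o e = 0]. *)
Lemma chi_injective_of_presentation Q M N N1 (e : {linear M -> N}) (d : {linear N -> N1}) :
  fg_projective (restr Q) -> in_add Q N -> in_add Q N1 ->
  surjective (precomp (T := Q) e) -> exact_at e d ->
  (exists s : {linear restr N1 -> restr N}, forall x, d (s (d x)) = d x) ->
  injective (chi Q M).
Proof.
move=> Qp /in_add_retraction[n [i [p ip]]] /in_add_retraction[m [i' [p' ip']]].
move=> eQ ed [s ds].
suff chi0 t : chi Q M t = 0 -> t = 0.
  move=> t u tu; apply/eqP; rewrite -subr_eq0; apply/eqP/chi0.
  by rewrite linearB tu subrr.
have [psi [-> ->]] := chi_expand Qp ip eQ t => psi0.
have psie x : dapp psi (e x) = 0 by rewrite -dapp_pull psi0.
have psid x : dapp psi x = dapp (rpull s psi) (d x).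
  have [y ye] : exists y, e y = x - s (d x).
    by apply/ed; rewrite linearB ds subrr.
  by apply/eqP; rewrite -subr_eq0 -dappB -ye psie.
set th := rpull s psi in psid.
have thE j : pull (p j) psi =
    \sum_l pull (i' l \o (d \o p j)) (pull (p' l) th).
  apply: dual_ext => x; rewrite dapp_sum dapp_pull psid -[in LHS](ip' (d (p j x))).
  by rewrite dapp_sumr.
rewrite (eq_bigr _ (fun j _ => congr1 _ (thE j))).
under eq_bigr do rewrite ptens_sumr.
rewrite exchange_big big1 // => l _.
under eq_bigr do rewrite -ptens_comp.
rewrite -ptens_sum.
have -> : lsum (fun j => (i' l \o (d \o p j)) \o (i j \o e)) =
    lsum (fun k : 'I_0 => e \; (\0 : {linear N -> Q})).
  apply: linear_ext => x; rewrite /= /lmap big_ord0 /=.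
  by rewrite -!linear_sum ip (ed _).2 ?linear0 //; exists x.
by rewrite ptens_sum big_ord0.
Qed.

(** Exactness of [D N1 -> D N -> D M] at [D N].  A functional [psi] on [N] that vanishes
    on the image of [e] gives a tensor over [M] killed by [chi], so that tensor is zero.
    On the other hand [Dg (x) h |-> h \o c], for a chosen [c] with [c \o e = g], is
    well defined modulo the functionals that factor through [d], and it sends this tensor
    to the class of [psi]. *)
Lemma dual_exact Q M N N1 n (i : 'I_n -> {linear N -> Q})
    (p : 'I_n -> {linear Q -> N}) (e : {linear M -> N}) (d : {linear N -> N1}) :
  fg_projective (restr Q) -> retraction i p -> injective (chi Q M) ->
  surjective (precomp (T := Q) e) ->
  (forall phi : {linear N -> Q}, (forall x, phi (e x) = 0) ->
     exists g, precomp d g = phi) ->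
  forall psi : dual N, (forall x, dapp psi (e x) = 0) ->
  exists th : dual N1, forall x, dapp psi x = dapp th (d x).
Proof.
move=> Qp ip chi_inj eQ dK psi psie.
have /choice[sec secP] : forall f : homD Q M, exists c : {linear N -> Q},
    pull (c \o e) = f.
  move=> f; have [g <-] := pull_surjective Qp f; have [c <-] := eQ g.
  by exists c.
have secE f h x :
    dapp h (sec f (e x)) = dapp ((f : {linear dual Q -> dual M}) h) x.
  by rewrite -[in RHS](secP f).
pose L (h : dual N) := exists th, h = pull d th.
have LQ (c : {linear N -> Q}) h : (forall x k, dapp k (c (e x)) = 0) -> L (pull c h).
  move=> ce; have [|g <-] := dK c; first by move=> x; apply: dual_separates Qp _.
  by exists (pull g h); rewrite -pull_comp.
have L0 : L 0 by exists 0; rewrite linear0.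
have LB x y : L x -> L y -> L (x - y).
  by move=> [x' ->] [y' ->]; exists (x' - y'); rewrite linearB.
pose m (f : homD Q M) (h : dualB Q) : dual N := pull (sec f) h.
pose s := [seq (pull (i j \o e) : homD Q M, pull (p j) psi : dualB Q)
          | j <- index_enum 'I_n].
have := @tens_sum_mod (opend Q) (homD Q M) (dualB Q) (dual N) L m L0 LB _ _ _ s.
case=> [f f' h|f h h'|f b h||th].
- rewrite (_ : _ - _ = pull (sec (f + f') - (sec f + sec f')) h).
    by apply: LQ => x k; rewrite /= dappB dappD !secE subrr.
  by apply: dual_ext => x; rewrite dapp_pull dappB dappD.
- by rewrite /m (linearD (pull (sec f))) subrr.
- rewrite (_ : _ - _ = pull (sec ((b : (opend Q)^c) *: f)
      - ((b : {linear Q -> Q}) \o sec f : {linear N -> Q})) h).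
    apply: LQ => x k; rewrite /= dappB secE.
    rewrite -[dapp k (_ (sec _ _))]
      /(dapp (pull (b : {linear Q -> Q}) k) (sec f (e x))).
    by rewrite secE pull_endo subrr.
  by apply: dual_ext => x; rewrite dapp_pull dappB.
- rewrite big_map; apply: chi_inj; rewrite linear0 linear_sum.
  apply: dual_ext => x.
  rewrite dapp_sum (eq_bigr (fun j => dapp psi (p j (i j (e x))))).
    by rewrite -dapp_sumr ip psie.
  by move=> j _; rewrite chi_ptens.
rewrite big_map => thE.
(* The chosen extension of i j \o e differs from i j by a map that kills e. *)
have [th' th'E] : L (\sum_j (pull (i j) (pull (p j) psi)
                              - m (pull (i j \o e)) (pull (p j) psi))).
  elim/big_ind: _ => // [x y Lx Ly|j _].
    by rewrite -[y]opprK; apply: (LB) => //; rewrite -sub0r; apply: (LB).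
  rewrite (_ : _ - _ = pull (i j - sec (pull (i j \o e))) (pull (p j) psi)).
    by apply: LQ => x k; rewrite /= dappB secE subrr.
  by apply: dual_ext => x; rewrite dapp_pull dappB.
exists (th' + th) => x.
rewrite -dapp_pull linearD -th'E -thE -big_split /=.
under eq_bigr do rewrite subrK.
by rewrite dapp_sum -{1}(ip x) dapp_sumr.
Qed.

End Algebra.

(** * Relative dominant dimension *)

Section DominantDimension.
Variables (R : comPzRingType) (A : algebra R) (Q M : lmodType A).

Lemma enat_sup_geP (S : nat -> Prop) n :
  (0 < n)%N -> (enat_le (Fin n) (enat_sup S) <-> exists2 k, (n <= k)%N & S k).
Proof.
move=> n_gt0; split=> [le_n|[k nk Sk]].
  apply: contrapT => nS; have : enat_le (enat_sup S) (Fin n.-1).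
    apply/enat_supP => k Sk /=; rewrite -ltnS prednK // ltnNge.
    by apply/negP => nk; apply: nS; exists k.
  case: (enat_sup S) le_n => [k|] //= nk kn.
  by have := leq_trans nk kn; rewrite -ltnS prednK // ltnn.
have /enat_supP/(_ k Sk) : enat_le (enat_sup S) (enat_sup S) by case: enat_sup => /=.
by case: (enat_sup S) => //= l; apply: leq_trans.
Qed.

(** For positive [n] the bound on the supremum is attained, possibly by a longer
    coresolution. *)
Lemma domdim_geP n : (0 < n)%N ->
  enat_le (Fin n) (domdim Q M) <->
  (exists (N : lmodType A) (f : {linear M -> N}), left_approx Q f /\ AR_mono f) /\
  (exists2 k, (n <= k)%N & has_coresolution Q M k).
Proof.
move=> n_gt0; rewrite /domdim; case: pselect => [ap|nap].
  by rewrite enat_sup_geP //; split=> [h|[]].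
by split=> [/=|[]//]; rewrite leqNgt n_gt0.
Qed.

Lemma has_coresolution1 (N : lmodType A) (e : {linear M -> N}) :
  in_add Q N -> surjective (precomp (T := Q) e) -> AR_mono e ->
  has_coresolution Q M 1.
Proof.
move=> QN eQ [s se]; exists (fun=> N), e, (fun=> idfun); split=> //.
split; first by split=> //= _ x y exy; rewrite -[x](se x) exy se.
by case=> // _; exists s => x; rewrite /= se.
Qed.

(** The map [e \o r] is a projection onto the image of [e], so the equation for [s] gives
    both exactness at [N] and the splitting of [d]. *)
Lemma has_coresolution2 (N N1 : lmodType A) (e : {linear M -> N})
    (d : {linear N -> N1}) (r : {linear restr N -> restr M})
    (s : {linear restr N1 -> restr N}) :
  in_add Q N -> in_add Q N1 -> surjective (precomp (T := Q) e) ->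
  (forall x, r (e x) = x) -> (forall x, d (e x) = 0) ->
  (forall x, s (d x) = x - e (r x)) ->
  (forall phi : {linear N -> Q}, (forall x, phi (e x) = 0) ->
     exists g, precomp d g = phi) ->
  has_coresolution Q M 2.
Proof.
move=> QN QN1 eQ re de sd dK.
pose C i := if i is 0%N then N else N1.
pose D i : {linear C i -> C i.+1} := if i is 0%N then d else idfun.
exists C, e, D; split; first by case.
- split.
    split=> [_ x y exy|[|//] _ x /=]; first by rewrite -[x](re x) exy re.
    split=> [dx|[y <-]]; last exact: de.
    exists (r x); apply/eqP; rewrite eq_sym -subr_eq0 -sd dx; apply/eqP.
    exact: (linear0 s).
  case=> [|[|//]] _; first by exists r => x /=; rewrite re.
  by exists s => x /=; rewrite sd linearB de subr0.
- split=> [_|[|//] _ phi /=]; first exact: eQ.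
  split=> [phie|[g <-]]; last first.
    by apply: linear_ext => x; rewrite /= de linear0.
  apply: dK => x; exact: (congr1 (fun k : {linear M -> Q} => k x) phie).
Qed.

(** Every functional on [M] extends along [e] when [chi] is surjective; applied to the
    coordinates of a dual basis of [M] this yields a retraction of [e]. *)
Lemma split_approx_of_chi_surjective :
  noetherian R -> fg_projective (restr Q) -> fin_gen M ->
  fg_projective (restr M) -> surjective (chi Q M) ->
  exists n (e : {linear M -> {ffun 'I_n -> Q}}),
    surjective (precomp (T := Q) e) /\ AR_mono e.
Proof.
move=> R_noeth Q_proj M_fg M_proj chi_surj.
have [n [e [_ eQ]]] :=
  approx_killing (\0 : {linear M -> M}) R_noeth M_fg Q_proj.1.
(* Every map kills the image of the zero map. *)
have {}eQ : surjective (precomp (T := Q) e).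
  by move=> phi; apply: eQ => x; rewrite linear0.
exists n, e; split=> //.
have [m [v [b vb]]] := fg_projective_dual_basis M_proj.
have [|r re] := dual_basis_factor (p := idfun) (d := restr_map e) vb;
  last by exists r.
move=> i; have [t tE] := chi_surj (b i).
have [psi [chit _]] := chi_expand Q_proj (@retraction_ffun _ _ Q n) eQ t.
by exists psi => x; rewrite /= -[LHS]/(dapp (b i : dual M) x) -tE chit.
Qed.

Lemma chi_surjectiveP :
  noetherian R -> fg_projective (restr Q) -> fin_gen M ->
  fg_projective (restr M) ->
  surjective (chi Q M) <-> enat_le (Fin 1) (domdim Q M).
Proof.
move=> R_noeth Q_proj M_fg M_proj; rewrite domdim_geP //.
split=> [chi_surj|[ap _]].
  have [n [e [eQ eR]]] :=
    split_approx_of_chi_surjective R_noeth Q_proj M_fg M_proj chi_surj.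
  have ap : left_approx Q e by apply: left_approx_add => //; apply: in_add_ffun.
  split; first by exists {ffun 'I_n -> Q}, e.
  by exists 1%N => //; apply: has_coresolution1 ap.1 eQ eR.
exact: chi_surjective_of_approx.
Qed.

Lemma chi_bijectiveP :
  noetherian R -> fin_gen Q -> fg_projective (restr Q) -> fin_gen M ->
  fg_projective (restr M) ->
  bijective (chi Q M) <-> enat_le (Fin 2) (domdim Q M).
Proof.
move=> R_noeth Q_fg Q_proj M_fg M_proj.
rewrite domdim_geP //; split=> [[g chiK gK]|].
  have chi_surj : surjective (chi Q M) by move=> h; exists (g h).
  have [n [e [eQ eR]]] :=
    split_approx_of_chi_surjective R_noeth Q_proj M_fg M_proj chi_surj.
  have ap : left_approx Q e by apply: left_approx_add => //; apply: in_add_ffun.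
  split; first by exists {ffun 'I_n -> Q}, e.
  (* d collects the maps out of Q^n that kill the image of e.  The projection q of Q^n
     along that image has coordinates vanishing there, which therefore factor through
     d. *)
  exists 2%N => //.
  have [m [d [de dK]]] :=
    approx_killing e R_noeth (fin_gen_ffun n Q_fg) Q_proj.1.
  have [r re] := eR.
  have dE := dual_exact Q_proj (@retraction_ffun _ _ Q n) (can_inj chiK) eQ dK.
  pose X := restr {ffun 'I_n -> Q}.
  pose q := (idfun : {linear X -> X}) - (restr_map e \o r : {linear X -> X}).
  have [J [v [b vb]]] := dual_basis_ffun n Q_proj.
  have [|s sd] := dual_basis_factor (p := q) (d := restr_map d) vb.
    move=> i; have [|th thE] := dE (rpull q (b i)); last by exists th => x; apply: thE.
    move=> x; rewrite -[LHS]/(dapp (b i : dual _) (e x - e (r (e x)))).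
    by rewrite re subrr dapp0.
  apply: (@has_coresolution2 _ _ e d r s) => //; exact: in_add_ffun.
move=> [ap [[|[|k]] // _ [N [e [d [QN [eEx eS] eH]]]]]].
have chi_surj := chi_surjective_of_approx Q_proj ap.
have chi_inj : injective (chi Q M).
  apply: (@chi_injective_of_presentation _ _ Q M (N 0%N) (N 1%N) e (d 0%N)) => //.
  - exact: QN.
  - exact: QN.
  - exact: eH.1.
  - exact: (eEx.2 0%N).
  - exact: (eS 1%N).
have [g gP] := choice chi_surj.
by exists g => [t|h]; [apply: chi_inj; rewrite gP | apply: gP].
Qed.
End DominantDimension.

Theorem theorem3p1p3 (R : comPzRingType) (A : algebra R) (Q : lmodType A)
  (R_noeth : noetherian R)
  (A_proj : fg_projective (restr (A := A) A^o))
  (Q_fg : fin_gen Q) (Q_proj : fg_projective (restr Q))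
  (EndQ_proj : fg_projective (homR Q Q)) :
  forall M : lmodType A, fin_gen M -> fg_projective (restr M) ->
    (surjective (chi Q M) <-> enat_le (Fin 1) (domdim Q M)) /\
    (bijective (chi Q M) <-> enat_le (Fin 2) (domdim Q M)).
Proof.
by move=> M M_fg M_proj; split; [apply: chi_surjectiveP | apply: chi_bijectiveP].
Qed.
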